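(* Let $\mathfrak O=\prod_{n\in\mathbb N}\mathbb Z/k_n\mathbb Z$ be an odometer system with its invariant measure $\mu$. Then $\mathfrak O$ is measure theoretically isomorphic to $(\mathbb K,\nu,sh)$ for some shift-invariant Borel probability measure $\nu$ on $\mathbb K$, where $\mathbb K$ is the limit of an odometer based construction sequence $\langle\mathcal W_n:n\in\mathbb N\rangle$ whose associated frequencies $f_n$ tend monotonically to zero exponentially fast; in particular $\sum_n f_n<\infty$.
   Context: Odometer: for integers $k_n\ge2$, $\prod_n\mathbb Z/k_n\mathbb Z$ with the homeomorphism that adds $(1,0,0,\dots)$ with carrying to the right; its unique invariant measure is the product of the uniform measures on the coordinates. Odometer based construction sequences: words are finite sequences from a finite alphabet $\Sigma$. A collection of words $\mathcal W$ is uniquely readable if whenever $u,v,w\in\mathcal W$ and $uv=pws$ (for words $p,s$), then $p$ or $s$ is empty. An odometer based construction sequence with coefficients $l_n\ge2$ is a sequence $\langle\mathcal W_n:n\in\mathbb N\rangle$ of collections of words such that: $\mathcal W_0=\Sigma$; for each $n$ all words in $\mathcal W_n$ have the same length and $\mathcal W_n$ is uniquely readable; each $w\in\mathcal W_n$ occurs at least once as a subword of every $w'\in\mathcal W_{n+1}$; and $\mathcal W_{n+1}\subseteq\mathcal W_n^{l_n}$ (concatenations of $l_n$ words of $\mathcal W_n$). The coefficients $l_n$ of the construction sequence are not required to equal the given $k_n$. Its limit $\mathbb K$ is the closed shift-invariant set of $x\in\Sigma^{\mathbb Z}$ such that every finite contiguous subword of $x$ occurs inside some $w\in\mathcal W_n$,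 for some $n$; $sh$ is the shift. Frequencies: for $w\in\mathcal W_n$, $w'\in\mathcal W_{n+1}$ let $Freq(w,w')$ be the number of occurrences of $w$ in $w'$ divided by $l_n=|w'|/|w|$. Put $f_n=\sup\{Freq(w,w'):w\in\mathcal W_n,\ w'\in\mathcal W_{n+1}\}$. ''Exponentially fast'' means $f_n\le Cr^n$ for some constants $C>0$ and $0<r<1$. *)

(* Defs.v *)
(* Library world: MathComp + MathComp-Analysis *)
From HB Require Import structures.
From mathcomp Require Import all_boot all_order all_algebra.
From mathcomp Require Import all_classical all_reals all_analysis.

Set Implicit Arguments.
Unset Strict Implicit.
Unset Printing Implicit Defensive.
Import Order.TTheory GRing.Theory Num.Theory.
Local Open Scope classical_set_scope.
Local Open Scope ring_scope.

(* Finite alphabets. The chosen point only records that the alphabet is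
   nonempty: the library's measurable types have to be pointed. *)
#[short(type="pointedFinType")]
HB.structure Definition PointedFinite := {T of isPointed T & Finite T}.

Notation borel T := (g_sigma_algebraType (@open T)).

(* The product over n of Z/k_n Z, with the product of the discrete topologies.
   Meaningful only if 1 < k n for all n: 'Z_0 and 'Z_1 also denote Z/2Z. *)
Definition odometer_space (k : nat -> nat) : Type :=
  prod_topology (fun n => discrete_topology 'Z_(k n)).
HB.instance Definition _ k := Topological.on (odometer_space k).
HB.instance Definition _ k :=
  isPointed.Build (odometer_space k) (fun n => 0 : 'Z_(k n)).

(* Adds (1, 0, 0, ...) with carrying to the right: a carry reaches the
   coordinate n iff every earlier digit is maximal, i.e. equal to k_i - 1. *)
Definition odometer_map (k : nat -> nat) (x : odometer_space k) :
    odometer_space k :=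
  fun n => let xn : 'Z_(k n) := x n in
    if [forall i : 'I_n, (x i : 'Z_(k i)) == -1] then xn + 1 else xn.

(* mu is the product of the uniform measures on the coordinates: its value on
   every measurable box with finitely many constrained sides. *)
Definition uniform_product (R : realType) (k : nat -> nat)
    (mu : probability (borel (odometer_space k)) R) : Prop :=
  forall (N : nat) (A : forall i, {set 'Z_(k i)}),
    mu [set x | forall i, (i < N)%N -> (x i : 'Z_(k i)) \in A i] =
    (\prod_(i < N) (#|A i|%:R / (k i)%:R))%:E.

(* Sigma^Z, with the product of the discrete topologies. *)
Definition bisequence (S : Type) : Type := {ptws int -> discrete_topology S}.
HB.instance Definition _ (S : choiceType) := Topological.on (bisequence S).
HB.instance Definition _ (S : pointedType) :=
  isPointed.Build (bisequence S) (fun=> point).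

Definition shift_map (S : Type) (x : bisequence S) : bisequence S :=
  fun i => x (i + 1).

Definition uniquely_readable (S : eqType) (W : set (seq S)) : Prop :=
  forall u v w, W u -> W v -> W w ->
  forall p s, u ++ v = p ++ w ++ s -> p = [::] \/ s = [::].

Record odometer_based (S : eqType) (l : nat -> nat) (W : nat -> set (seq S)) :
    Prop := OdometerBased {
  coeff_ge2 : forall n, (2 <= l n)%N ;
  words0 : W 0 = range (fun a : S => [:: a]) ;
  words_size : forall n u v, W n u -> W n v -> size u = size v ;
  words_readable : forall n, uniquely_readable (W n) ;
  words_occur : forall n w w', W n w -> W n.+1 w' -> infix w w' ;
  words_concat : forall n w', W n.+1 w' ->
    exists2 t : (l n).-tuple (seq S),
      (forall u, u \in t -> W n u) & w' = flatten t }.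

Definition limit_system (S : eqType) (W : nat -> set (seq S)) :
    set (bisequence S) :=
  [set x | forall (i : int) (m : nat), exists n w,
     W n w /\ infix (mkseq (fun j => x (i + j%:Z) : S) m) w].

Definition nb_occurrences (S : eqType) (w w' : seq S) : nat :=
  #|[set i : 'I_(size w').+1 | prefix w (drop i w')]|.

(* w is in W n and w' in W n.+1 for the n-th coefficient ln. *)
Definition freq (R : realType) (S : eqType) (ln : nat) (w w' : seq S) : R :=
  (nb_occurrences w w')%:R / ln%:R.

Definition sup_freq (R : realType) (S : eqType) (l : nat -> nat)
    (W : nat -> set (seq S)) (n : nat) : R :=
  sup [set freq R (l n) w w' | w in W n & w' in W n.+1].

Definition exponentially_fast (R : realType) (f : nat -> R) : Prop :=
  exists C r : R, [/\ 0 < C, 0 < r, r < 1 & forall n, f n <= C * r ^+ n].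

Definition invariant_measure d (T : measurableType d) (R : realType)
    (nu : probability T R) (f : T -> T) : Prop :=
  forall E, measurable E -> nu (f @^-1` E) = nu E.

(* Isomorphism of measure-preserving systems: an equivariant, bimeasurable and
   measure-preserving bijection between invariant measurable sets of full
   measure. *)
Definition mt_isomorphic (R : realType) d1 (X : measurableType d1)
    (mu : probability X R) (f : X -> X) d2 (Y : measurableType d2)
    (nu : probability Y R) (g : Y -> Y) : Prop :=
  exists (A : set X) (B : set Y) (phi : X -> Y),
    [/\ [/\ measurable A, mu A = 1%E & f @` A `<=` A],
        [/\ measurable B, nu B = 1%E & g @` B `<=` B],
        set_bij A B phi,
        [/\ measurable_fun A phi,
            forall E, measurable E -> E `<=` A -> measurable (phi @` E) &
            forall F, measurable F -> mu (A `&` phi @^-1` F) = nu F] &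
        forall x, A x -> phi (f x) = g (phi x)].

(* Main.v *)
(* There are s_n = 2^(n+2) words at level n, and a word of level n+1 is a
   concatenation of l_n words of level n, where l_n is the product of a block of
   consecutive k_i and is large compared with s_n and s_(n+1).  A word starts
   with two copies of word 0, which makes it recognisable; its number is coded
   in the next s_(n+1) places; the remaining places run cyclically through all
   words of level n and are the same for every word of level n+1.  Hence
   1/s_n <= f_n <= 2/s_n.

   A point y of the odometer is the coherent sequence of its residues P_n(y)
   modulo h_n = l_0 ... l_(n-1), read as the position of the origin inside its
   word of level n.  As soon as the block of level n containing the origin lies
   in the common part, with both neighbouring blocks, the letters at distance at
   most h_n from the origin are determined by P_(n+1)(y) alone.  Almost every y
   has this property for infinitely many n, which gives an equivariant map into
   the limit system.  Conversely unique readability recovers every P_n(y) from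
   the image, so that the map is injective with measurable images. *)
Require Import Defs.
From HB Require Import structures.
From mathcomp Require Import all_boot all_order all_algebra zify lra.
From mathcomp Require Import all_classical all_reals all_analysis.

Set Implicit Arguments.
Unset Strict Implicit.
Unset Printing Implicit Defensive.
Import Order.TTheory GRing.Theory Num.Theory.
Import numFieldNormedType.Exports.
Local Open Scope classical_set_scope.
Local Open Scope ring_scope.

(** * Words and unique readability *)

Section Words.
Local Open Scope nat_scope.

Definition nwords n := 2 ^ n.+2.

Lemma nwords_ge4 n : 4 <= nwords n.
Proof. by rewrite /nwords (@leq_exp2l 2 2). Qed.

Lemma nwordsS n : nwords n.+1 = 2 * nwords n.
Proof. by rewrite /nwords expnS. Qed.

Variable l : nat -> nat.
Hypothesis hl : forall n, nwords n * (nwords n.+1 + 5) <= l n.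

Definition height n := \prod_(i < n) l i.

(* The number, among the words of level [n], of the [i]-th block of the [j]-th
   word of level [n.+1]: a marker [0 0], then [j] coded in unary by the place of
   the only [2] among [1]s, then the common part.  Its last block is [1], so that
   no [0] precedes the marker of the next word. *)
Definition block_type n j i : nat :=
  if i < 2 then 0
  else if i < nwords n.+1 + 2 then if i == j + 2 then 2 else 1
  else if i == (l n).-1 then 1
  else i %% nwords n.

(** Total in [j] and [p]; it describes a word when [j < nwords n] and [p < height n]. The four words
    of level 0 are the letters. *)
Fixpoint letter n j p : 'I_4 :=
  if n is m.+1 then letter m (block_type m j (p %/ height m)) (p %% height m)
  else inord j.

Definition word n j := mkseq (letter n j) (height n).

Lemma l_large n : nwords n.+1 + nwords n + 8 <= l n.
Proof. by have := hl n; have := nwords_ge4 n; have := nwords_ge4 n.+1; nia. Qed.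

Lemma heightS n : height n.+1 = l n * height n.
Proof. by rewrite /height big_ord_recr mulnC. Qed.

Lemma height0 : height 0 = 1.
Proof. by rewrite /height big_ord0. Qed.

Lemma height_gt n : n < height n.
Proof.
elim: n => [|n IH]; first by rewrite height0.
by rewrite heightS; have := l_large n; nia.
Qed.

Lemma height_gt0 n : 0 < height n.
Proof. exact: leq_ltn_trans (height_gt n). Qed.

Lemma dvdn_height m n : m <= n -> height m %| height n.
Proof.
move=> /subnK <-; elim: (n - m) => [|d IH] //.
by rewrite addSn heightS dvdn_mull.
Qed.

Lemma block_type_lt n j i : block_type n j i < nwords n.
Proof.
have := nwords_ge4 n; rewrite /block_type => s4.
by do !case: ifP => _ //; rewrite ?ltn_mod; lia.
Qed.

Lemma letter_block n j i p : p < height n ->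
  letter n.+1 j (i * height n + p) = letter n (block_type n j i) p.
Proof.
move=> ph /=; rewrite divnMDl ?height_gt0// divn_small// addn0.
by rewrite modnMDl modn_small.
Qed.

(** If [height n = c * height m], block [i] of level [m] in a word of level [n.+1] is block [i %% c]
    of the word of level [n] at place [i %/ c]; hence the induction. *)
Lemma letter_subblock m n j i : m < n -> exists2 j', j' < nwords m &
  forall p, p < height m -> letter n j (i * height m + p) = letter m j' p.
Proof.
elim: n j i => // n IH j i; rewrite ltnS leq_eqVlt => /predU1P[->|mn].
  by exists (block_type n j i) => [|p ph]; [exact: block_type_lt|exact: letter_block].
have /dvdnP[c hc] := dvdn_height (ltnW mn).
have [j' j's hj'] := IH (block_type n j (i %/ c)) (i %% c) mn.
exists j' => // p ph; rewrite -hj'//.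
have c0 : 0 < c by have := height_gt0 n; rewrite hc; case: (c).
have lt : i %% c * height m + p < height n.
  by have := ltn_pmod i c0; rewrite hc; nia.
rewrite -letter_block// hc mulnA [in LHS](divn_eq i c).
by congr letter; lia.
Qed.

(** By induction the block types agree at every place, and place [j + 2] of word [j] holds the only
    2 of its code. *)
Lemma letter_inj n j j' : j < nwords n -> j' < nwords n ->
  (forall p, p < height n -> letter n j p = letter n j' p) -> j = j'.
Proof.
elim: n j j' => [|n IH] j j' js j's eqj.
  have /(congr1 (@nat_of_ord _)) := eqj 0 (height_gt0 0).
  by rewrite /= !inordK.
have codeE i : i < l n -> block_type n j i = block_type n j' i.
  move=> il; apply: IH; [exact: block_type_lt..|] => p ph.
  rewrite -!letter_block//; apply: eqj; rewrite heightS; nia.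
have := l_large n => ll.
have /codeE : j + 2 < l n by lia.
rewrite /block_type; have := nwords_ge4 n => s4.
by do !case: ifP; lia.
Qed.

(** After place 0, a block 0 is the second half of the marker, followed by the code, or sits at a
    multiple of [nwords n] in the cyclic part, followed by 1. The last block is 1. *)
Lemma block_type_no_double0 n j i : 0 < i < l n -> block_type n j i = 0 ->
  i.+1 < l n /\ block_type n j i.+1 <> 0.
Proof.
rewrite /block_type; have := nwords_ge4 n; have := l_large n => ll s4 i0.
have modS : i %% nwords n = 0 -> i.+1 %% nwords n = 1.
  by move=> i00; rewrite -addn1 -modnDml i00 modn_small//; lia.
by have := nwords_ge4 n.+1; do !case: ifP; lia.
Qed.

(* Two consecutive words [x] contain no word at an intermediate offset: by
   induction the offset is a multiple of the lower height, and a word of the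
   higher level starts with two blocks [0], which occur nowhere else. *)
Lemma letter_readable n (x : nat -> 'I_4) (t : nat -> nat) j o :
  (forall q, q < 2 -> t q < nwords n) -> j < nwords n ->
  (forall q p, q < 2 -> p < height n -> x (q * height n + p) = letter n (t q) p) ->
  (forall p, p < height n -> x (o + p) = letter n j p) ->
  o < height n -> o = 0.
Proof.
elim: n x t j o => [|n IH] x t j o ts js xt xo oh.
  by move: oh; rewrite height0; case: o {xo}.
have ll := l_large n; have h0 := height_gt0 n.
have ltM q p L : q < L -> p < height n -> q * height n + p < L * height n by nia.
have xb i p : i < 2 * l n -> p < height n ->
    x (i * height n + p) = letter n (block_type n (t (i %/ l n)) (i %% l n)) p.
  move=> i2 ph; have l0 : 0 < l n by lia.
  have [qi ql] : i %/ l n < 2 /\ i %% l n < l n.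
    by rewrite ltn_divLR// ltn_mod.
  rewrite -letter_block// -xt//; last by rewrite heightS ltM.
  by congr (x _); rewrite heightS {1}(divn_eq i (l n)); lia.
have xbo i p : i < l n -> p < height n ->
    x (o + (i * height n + p)) = letter n (block_type n j i) p.
  by move=> il ph; rewrite -letter_block// xo// heightS ltM.
have oE := divn_eq o (height n); set Q := o %/ height n in oE.
have Ql : Q < l n by rewrite ltn_divLR// -heightS.
have o0 : o %% height n = 0.
  (* The first block of the word at [o] lies within the blocks [Q] and [Q + 1], to which the
     induction hypothesis applies. *)
  pose x' p := x (Q * height n + p).
  pose t' q := block_type n (t ((Q + q) %/ l n)) ((Q + q) %% l n).
  apply: (IH x' t' (block_type n j 0)); rewrite ?ltn_mod//.
  - by move=> q _; exact: block_type_lt.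
  - exact: block_type_lt.
  - by move=> q p q2 ph; rewrite /x' addnA -mulnDl xb//; lia.
  - move=> p ph; rewrite /x' addnA -oE -xbo//; last lia.
rewrite o0 addn0 in oE.
have cQ i : i < l n ->
    block_type n (t ((Q + i) %/ l n)) ((Q + i) %% l n) = block_type n j i.
  move=> il; apply: (@letter_inj n); [exact: block_type_lt..|] => p ph.
  by rewrite -xb//; [rewrite -xbo//; congr (x _); lia|lia].
(* If [Q > 0], the marker of the word at [o] puts a block 0 at place [Q] of the first word and
   another right after it, which [block_type_no_double0] excludes. *)
have [Q0|Q0] := posnP Q; first by rewrite oE Q0.
have l1 : 1 < l n by lia.
have := cQ 0 (ltnW l1); have := cQ 1 l1; rewrite /block_type/= -!/(block_type _ _ _).
rewrite addn0 (modn_small Ql) (divn_small Ql) => c1 c0.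
have [Q1l] := @block_type_no_double0 n (t 0) Q (introT andP (conj Q0 Ql)) c0.
by move: c1; rewrite addn1 modn_small// divn_small// => ->.
Qed.

Lemma block_type_common n j j' i : nwords n.+1 + 2 <= i ->
  block_type n j i = block_type n j' i.
Proof. by rewrite /block_type leqNgt => /negbTE ->; case: ifP. Qed.

Lemma block_type_onto n c : c < nwords n -> exists i,
  [/\ nwords n.+1 + 2 <= i, i < l n & forall j, block_type n j i = c].
Proof.
(* The witness lies [c] places after the first multiple of [nwords n] beyond [nwords n.+1 + 2]; [hl]
   leaves room for it before the last block. *)
move=> cs; have ll := l_large n; have s4 := nwords_ge4 n.
exists ((nwords n.+1 + 2) %/ nwords n * nwords n + nwords n + c).
have E := divn_eq (nwords n.+1 + 2) (nwords n).
have R : (nwords n.+1 + 2) %% nwords n < nwords n by rewrite ltn_mod; lia.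
have := hl n; split; [lia|nia|move=> j].
rewrite /block_type ifF; last by lia.
rewrite ifF; last by lia.
rewrite ifF; last by nia.
by rewrite -mulSnr modnMDl modn_small.
Qed.

End Words.

(** * Sets of words and counting of occurrences *)

Section WordSets.
Local Open Scope nat_scope.

Lemma card_le_inj m N (A : {set 'I_m}) (f : nat -> nat) :
  (forall q, q \in A -> f q < N) ->
  (forall q r, q \in A -> r \in A -> f q = f r -> q = r) -> #|A| <= N.
Proof.
case: N => [|N] fN fI.
  rewrite leqn0 cards_eq0; apply/eqP/setP => q; rewrite inE.
  by apply/negP => /fN.
rewrite -[N.+1]card_ord -(card_in_imset (f := fun q : 'I_m => inord (f q) : 'I_N.+1)).
  exact: max_card.
move=> q r qA rA /(congr1 val); rewrite /= !inordK ?fN//; exact: fI.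
Qed.

Lemma sum_card_fibers m s (f : 'I_m -> 'I_s) :
  \sum_(i < s) #|[set q | f q == i]%SET| = m.
Proof.
rewrite -[RHS]card_ord -sum1_card (partition_big f predT)//=.
by apply: eq_bigr => i _; rewrite -sum1_card; apply: eq_bigl => q; rewrite inE.
Qed.

Lemma prefix_drop_nth (T : eqType) (x0 : T) (u w : seq T) o :
  reflect (o + size u <= size w /\
           forall p, p < size u -> nth x0 w (o + p) = nth x0 u p)
    ((size u == 0) && (o <= size w) || (0 < size u) && prefix u (drop o w)).
Proof.
Abort.

(** For empty [u] the prefix test would succeed even beyond the end of [w]. *)
Lemma prefix_drop_nth (T : eqType) (x0 : T) (u w : seq T) o : u != [::] ->
  reflect (o + size u <= size w /\
           forall p, p < size u -> nth x0 w (o + p) = nth x0 u p)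
    (prefix u (drop o w)).
Proof.
move=> u0; have {}u0 : 0 < size u by rewrite lt0n size_eq0.
apply: (iffP idP) => [pu|[ow uw]].
  have := size_prefix pu; rewrite size_drop => sz.
  split=> [|p pu']; first by lia.
  have /prefixP[s dE] := pu.
  by rewrite -nth_drop dE nth_cat pu'.
rewrite prefixE; apply/eqP/(@eq_from_nth _ x0) => [|p].
  by rewrite size_take size_drop; case: ifP; lia.
rewrite size_take size_drop => pu.
have {}pu : p < size u by move: pu; case: ifP; lia.
by rewrite nth_take// nth_drop uw.
Qed.

Variable l : nat -> nat.
Hypothesis hl : forall n, nwords n * (nwords n.+1 + 5) <= l n.
Local Notation height := (height l).
Local Notation block_type := (block_type l).
Local Notation letter := (letter l).
Local Notation word := (word l).
Let height_gt0 := height_gt0 hl.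

Definition words n : set (seq 'I_4) := [set word n j | j in `I_(nwords n)].

Lemma size_word n j : size (word n j) = height n.
Proof. exact: size_mkseq. Qed.

Lemma nth_word n j p : p < height n -> nth ord0 (word n j) p = letter n j p.
Proof. exact: nth_mkseq. Qed.

Lemma word_neq0 n j : word n j != [::].
Proof. by rewrite -size_eq0 size_word -lt0n height_gt0. Qed.

Lemma prefix_word n i j q : q < l n -> block_type n j q = i ->
  prefix (word n i) (drop (q * height n) (word n.+1 j)).
Proof.
move=> ql <-; apply/(prefix_drop_nth ord0); rewrite ?word_neq0//.
rewrite !size_word heightS; split=> [|p ph]; first by nia.
by rewrite !nth_word ?heightS// ?(letter_block hl)//; nia.
Qed.

(** An occurrence starting strictly inside block [Q] would put a word at an intermediate offset of
    the blocks [Q] and [Q + 1], against [letter_readable]. *)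
Lemma prefix_wordP n i j o : i < nwords n -> j < nwords n.+1 ->
  prefix (word n i) (drop o (word n.+1 j)) ->
  exists q, [/\ q < l n, o = q * height n & block_type n j q = i].
Proof.
move=> si sj /(prefix_drop_nth ord0 _ _ (word_neq0 n i)).
have h0 := height_gt0 n.
rewrite !size_word heightS => -[oh ow].
have {}ow p : p < height n -> letter n.+1 j (o + p) = letter n i p.
  by move=> ph; rewrite -nth_word ?ow ?nth_word// heightS; lia.
have oE := divn_eq o (height n); set Q := o %/ height n in oE.
have ltm := ltn_pmod o h0.
have o0 : o %% height n = 0.
  have [//|o0] := posnP (o %% height n).
  apply: (letter_readable hl (x := fun p => letter n.+1 j (Q * height n + p))
    (t := fun q => block_type n j (Q + q)) (j := i)).
  - by move=> q _; exact: block_type_lt.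
  - by [].
  - by move=> q p q2 ph; rewrite addnA -mulnDl (letter_block hl).
  - by move=> p ph; rewrite addnA -oE ow.
  - by [].
rewrite o0 addn0 in oE; exists Q; split=> //; first by nia.
apply: (letter_inj hl (n := n)) => // [|p ph]; first exact: block_type_lt.
by rewrite -(letter_block hl)// -ow// oE.
Qed.

Lemma nb_occurrences_word n i j : i < nwords n -> j < nwords n.+1 ->
  nb_occurrences (word n i) (word n.+1 j) =
  #|[set q : 'I_(l n) | block_type n j q == i]%SET|.
Proof.
move=> si sj; have h0 := height_gt0 n.
have lt (q : 'I_(l n)) : q * height n < (size (word n.+1 j)).+1.
  by rewrite size_word heightS; have := ltn_ord q; nia.
rewrite /nb_occurrences -(card_in_imset (f := fun q => Ordinal (lt q))).
  apply: eq_card => o; apply/idP/imsetP => [/set_mem/=|[q + ->]]; last first.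
    by rewrite inE => /eqP cq; apply/mem_set/prefix_word.
  move/(prefix_wordP si sj) => [q [ql oE cq]].
  by exists (Ordinal ql); [rewrite inE; exact/eqP|exact: val_inj].
move=> q r _ _ [] /eqP; rewrite eqn_pmul2r// => /eqP; exact: val_inj.
Qed.

(** Type [i] fills one place out of [nwords n] in the cyclic part and, at worst, all the other
    [nwords n.+1 + 3] places. The map [f] injects its places accordingly, and [hl] absorbs the
    constant. *)
Lemma nb_occurrences_ub n i j : i < nwords n -> j < nwords n.+1 ->
  nb_occurrences (word n i) (word n.+1 j) * nwords n <= 2 * l n.
Proof.
move=> si sj; rewrite nb_occurrences_word//.
have := hl n; have ll := l_large hl n; have s4 := nwords_ge4 n.
pose f q := if q < nwords n.+1 + 2 then q
  else if q == (l n).-1 then nwords n.+1 + 2 else nwords n.+1 + 3 + q %/ nwords n.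
suff : #|[set q : 'I_(l n) | block_type n j q == i]%SET| <=
    nwords n.+1 + 4 + l n %/ nwords n.
  have := leq_divM (l n) (nwords n); nia.
have cE q : block_type n j q == i -> nwords n.+1 + 2 <= q -> q != (l n).-1 ->
    q %% nwords n = i.
  by rewrite /block_type => /eqP; do !case: ifP; lia.
apply: (card_le_inj (f := f)) => [q|q r]; rewrite !inE.
  rewrite /f => cq; have := leq_div2r (nwords n) (ltnW (ltn_ord q)).
  by move: (_ %/ _) (_ %/ _) => c d; do !case: ifP; lia.
move=> /cE cq /cE cr fqr; apply: val_inj => /=.
move: (divn_eq q (nwords n)) (divn_eq r (nwords n)) cq cr fqr; rewrite /f.
move: (q %/ _) (r %/ _) (q %% _) (r %% _) => a b c d qE rE cq cr.
by case: (ltnP q) cq => q1 cq; case: (ltnP r) cr => r1 cr; do ?case: ifP; lia.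
Qed.

(** Pigeonhole: the [l n] blocks are shared among [nwords n] types, so some type reaches the
    average. *)
Lemma nb_occurrences_lb n j : j < nwords n.+1 -> exists2 i, i < nwords n &
  l n <= nb_occurrences (word n i) (word n.+1 j) * nwords n.
Proof.
move=> sj; apply: contrapT => no.
have lt i : i < nwords n ->
    #|[set q : 'I_(l n) | block_type n j q == i]%SET| * nwords n < l n.
  move=> si; rewrite -nb_occurrences_word// ltnNge; apply/negP => le.
  by apply: no; exists i.
pose f (q : 'I_(l n)) := Ordinal (block_type_lt l n j q).
have s0 : 0 < nwords n by have := nwords_ge4 n; lia.
have l0 := lt 0 s0.
have le (i : 'I_(nwords n)) : true ->
    #|[set q | f q == i]%SET| * nwords n <= (l n).-1.
  by move=> _; have : #|[set q | f q == i]%SET| * nwords n < l n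
    := lt i (ltn_ord i); lia.
have := leq_sum (index_enum _) le; rewrite -big_distrl/= sum_card_fibers.
by rewrite sum_nat_const card_ord mulnC; nia.
Qed.

Lemma flatten_mkseq (T : Type) (f : nat -> T) m h :
  mkseq f (m * h) = flatten (mkseq (fun q => mkseq (fun p => f (q * h + p)) h) m).
Proof.
elim: m => // m IH; rewrite [in RHS]/mkseq -addn1 iotaD map_cat flatten_cat /=.
rewrite cats0 -/(mkseq _ m) -IH addn1 mulSnr /mkseq iotaD map_cat add0n.
by rewrite -{2}(addn0 (m * h)) iotaDl -map_comp add0n.
Qed.

Lemma word_flatten n j :
  word n.+1 j = flatten (mkseq (fun q => word n (block_type n j q)) (l n)).
Proof.
rewrite /word heightS flatten_mkseq; congr flatten.
apply: eq_map => q; apply/eq_in_map => p; rewrite mem_iota => /andP[_ ph].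
exact: letter_block.
Qed.

(** With [p] and [s] both nonempty, [w] would start strictly inside the first word of [u ++ v]. *)
Lemma words_uniquely_readable n : uniquely_readable (words n).
Proof.
move=> _ _ _ [j1 s1 <-] [j2 s2 <-] [j s3 <-] p s E.
have sE := congr1 size E; rewrite !size_cat !size_word in sE.
have [p0|p0] := posnP (size p); first by left; exact: size0nil.
have [s0|s0] := posnP (size s); first by right; exact: size0nil.
suff p00 : size p = 0 by rewrite p00 in p0.
pose u := word n j1 ++ word n j2.
apply: (letter_readable hl (n := n) (x := nth ord0 u) (j := j)
   (t := fun q => if q is 0 then j1 else j2)); last by lia.
- by case.
- by [].
- move=> [|[|//]] q _ qh; rewrite /u nth_cat size_word.
    by rewrite mul0n add0n qh nth_word.
  by rewrite mul1n ifF ?addKn ?nth_word//; lia.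
- move=> q qh; rewrite /u E nth_cat ltnNge leq_addr /=.
  by rewrite addKn nth_cat size_word qh nth_word.
Qed.

Lemma l_ge2 n : 2 <= l n.
Proof. by have := l_large hl n; lia. Qed.

Lemma words_odometer_based : odometer_based l words.
Proof.
split.
- exact: l_ge2.
- have w0 j : word 0 j = [:: inord j] by rewrite /word/mkseq height0.
  apply/seteqP; split=> [_ [j _ <-]|_ [a _ <-]]; first by exists (inord j).
  by exists a; [exact: ltn_ord|rewrite w0 inord_val].
- by move=> n _ _ [i _ <-] [j _ <-]; rewrite !size_word.
- exact: words_uniquely_readable.
- move=> n _ _ [i si <-] [j sj <-].
  have [q [_ ql cq]] := block_type_onto hl si.
  have /prefixP[t tE] := prefix_word ql (cq j).
  apply/infixP; exists (take (q * height n) (word n.+1 j)), t.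
  by rewrite -tE cat_take_drop.
- move=> n _ [j sj <-].
  exists (mktuple (fun q : 'I_(l n) => word n (block_type n j q))) => [u|].
    case/mapP => q _ ->; exists (block_type n j q) => //; exact: block_type_lt.
  rewrite word_flatten; congr flatten.
  by rewrite /= /mkseq -val_enum_ord -map_comp.
Qed.

End WordSets.

(** * Frequencies *)

Section Freq.
Variable R : realType.
Variable l : nat -> nat.
Hypothesis hl : forall n, (nwords n * (nwords n.+1 + 5) <= l n)%N.
Local Notation f := (sup_freq R l (words l)).

Let freqs n := [set freq R (l n) w w' | w in words l n & w' in words l n.+1].

Let s_gt0 n : 0 < (nwords n)%:R :> R.
Proof. by rewrite ltr0n (leq_trans _ (nwords_ge4 n)). Qed.

Let l_gt0 n : 0 < (l n)%:R :> R.
Proof. by rewrite ltr0n (leq_trans _ (l_ge2 hl n)). Qed.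

Let freqs_ub n x : freqs n x -> x <= 2 / (nwords n)%:R.
Proof.
case=> _ [i si <-] [_ [j sj <-] <-].
rewrite /freq ler_pdivrMr// mulrAC ler_pdivlMr// -!natrM ler_nat.
exact: nb_occurrences_ub.
Qed.

Let freqs_has_sup n : has_sup (freqs n).
Proof.
have s0 m : (0 < nwords m)%N by rewrite (leq_trans _ (nwords_ge4 m)).
split; last by exists (2 / (nwords n)%:R) => x; exact: freqs_ub.
by eexists; exists (word l n 0); [by exists 0%N; first exact: s0|];
  exists (word l n.+1 0); [by exists 0%N; first exact: s0|].
Qed.

Lemma sup_freq_ub n : f n <= 2 / (nwords n)%:R.
Proof. by apply: ge_sup => [|x]; [case: (freqs_has_sup n)|exact: freqs_ub]. Qed.

Lemma sup_freq_lb n : (nwords n)%:R^-1 <= f n.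
Proof.
have s0 m : (0 < nwords m)%N by rewrite (leq_trans _ (nwords_ge4 m)).
have [i si hi] := nb_occurrences_lb hl (s0 n.+1).
apply: (@le_trans _ _ (freq R (l n) (word l n i) (word l n.+1 0))).
  by rewrite /freq ler_pdivlMr// mulrC ler_pdivrMr// -natrM ler_nat.
apply: (sup_upper_bound (freqs_has_sup n)).
exists (word l n i); first by exists i.
by exists (word l n.+1 0) => //; exists 0%N; rewrite /= ?s0.
Qed.

(** As [nwords] doubles at each level, the upper bound at level [n.+1] is exactly the lower bound at
    level [n]. *)
Lemma sup_freq_nonincreasing : nonincreasing_seq f.
Proof.
apply/nonincreasing_seqP => n; apply: le_trans (sup_freq_ub _) _.
apply: le_trans (sup_freq_lb _); rewrite nwordsS natrM invfM mulrA divff//.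
by rewrite mul1r.
Qed.

Lemma sup_freq_geometric n : f n <= 2^-1 ^+ n.
Proof.
apply: le_trans (sup_freq_ub _) _.
rewrite ler_pdivrMr// /nwords natrX 2!exprS mulrCA.
by rewrite [_ ^+ n * _]mulrCA -exprMn mulVf// expr1n; lra.
Qed.

Lemma sup_freq_ge0 n : 0 <= f n.
Proof. by apply: le_trans (sup_freq_lb _); rewrite invr_ge0. Qed.

Lemma sup_freq_cvgn_series : cvgn (series f).
Proof.
apply: (@series_le_cvg _ _ (geometric 1 2^-1)) => [n|n|n|].
- exact: sup_freq_ge0.
- by rewrite /geometric/= mul1r exprn_ge0.
- by rewrite /geometric/= mul1r sup_freq_geometric.
- by apply: is_cvg_geometric_series; rewrite ger0_norm//; lra.
Qed.

Lemma sup_freq_cvg0 : f @ \oo --> (0 : R).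
Proof. exact: cvg_series_cvg_0 sup_freq_cvgn_series. Qed.

Lemma sup_freq_exponentially_fast : exponentially_fast f.
Proof.
exists 1, 2^-1; split=> [|||n]; [lra..|rewrite mul1r].
exact: sup_freq_geometric.
Qed.

End Freq.

(** * Reading bi-infinite sequences *)

Section Config.
Variable l : nat -> nat.
Hypothesis hl : forall n, (nwords n * (nwords n.+1 + 5) <= l n)%N.
Local Notation height := (height l).
Local Notation block_type := (block_type l).
Local Notation letter := (letter l).
Local Notation word := (word l).
Let height_gt0 := height_gt0 hl.
Implicit Types (n r : nat) (x : bisequence 'I_4) (P : nat -> nat).

(* [x] is a concatenation of words of level [n], the origin being at place [r]
   (modulo the height) of its word. *)
Definition parsed n r x := forall q : int, exists2 j, (j < nwords n)%N &
  forall p, (p < height n)%N ->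
    x (q * (height n)%:Z + p%:Z - r%:Z) = letter n j p.

(* For a position [r] inside a word of level [n.+1], the block of level [n]
   containing [r] and its two neighbours lie in the common part or are the last
   block, hence do not depend on the word. *)
Definition good n r :=
  (nwords n.+1 + 3 <= r %/ height n)%N && (r %/ height n + 2 <= l n)%N.

(** These are the elements of the inverse limit of the cyclic groups of order [height n], given by
    least residues. *)
Definition coherent P := forall n, (P n.+1 %% height n)%N = P n.

Definition good_often P := forall N, exists2 n, (N <= n)%N & good n (P n.+1).

Lemma coherent_lt P n : coherent P -> (P n < height n)%N.
Proof. by move=> <-; rewrite ltn_mod. Qed.

Lemma coherent_mod P m n : coherent P -> (m <= n)%N -> (P n %% height m)%N = P m.
Proof.
move=> cP /subnK <-; elim: (n - m)%N => [|d IH].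
  by rewrite add0n modn_small// coherent_lt.
by rewrite -IH -(cP (d + m)%N) modn_dvdm// dvdn_height// leq_addl.
Qed.

Lemma parsed_pred n r x : parsed n.+1 r x -> parsed n (r %% height n) x.
Proof.
(* Blocks are renumbered from the position [- r], where a word of level [n.+1] starts; [Q] is then
   split into word and place. *)
move=> px q; pose Q := q + (r %/ height n)%:Z.
have l0 : (0 < l n)%N by have := l_ge2 hl n; lia.
have [j sj jE] := px (Q %/ (l n)%:Z)%Z.
have QE := divz_eq Q (l n)%:Z.
have Q0 : (0 <= (Q %% (l n)%:Z)%Z) by rewrite modz_ge0//; lia.
have Ql : (Q %% (l n)%:Z)%Z < (l n)%:Z by rewrite ltz_pmod//; lia.
pose d := `|(Q %% (l n)%:Z)%Z|%N.
have dE : (Q %% (l n)%:Z)%Z = d%:Z by rewrite /d; lia.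
exists (block_type n j d) => [|p ph]; first exact: block_type_lt.
rewrite -letter_block// -jE; last by rewrite heightS; nia.
congr (x _); rewrite heightS PoszM; rewrite dE in QE.
have := divn_eq r (height n); rewrite /Q in QE; nia.
Qed.

Lemma parsed_le m n r x : (m <= n)%N -> parsed n r x -> parsed m (r %% height m) x.
Proof.
move=> /subnK <-; elim: (n - m)%N r => [|d IH] r px.
  move=> q; have [j sj jE] := px (q + (r %/ height m)%:Z); exists j => // p ph.
  rewrite -jE//; congr (x _); rewrite add0n.
  have := divn_eq r (height m); nia.
have /IH := parsed_pred px.
by rewrite modn_dvdm// dvdn_height// leq_addl.
Qed.

(** For [r <= r'], two consecutive words start at [- r'] and another word at offset [r' - r] from
    there, so [letter_readable] makes this offset 0. *)
Lemma parsed_inj n r r' x : (r < height n)%N -> (r' < height n)%N ->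
  parsed n r x -> parsed n r' x -> r = r'.
Proof.
wlog rr' : r r' / (r <= r')%N => [W|].
  have [rr'|/ltnW rr'] := leqP r r'; first exact: W.
  by move=> *; apply/esym/W.
move=> rh r'h px px'; suff : (r' - r = 0)%N by lia.
have [j0 s0 e0] := px' 0; have [j1 s1 e1] := px' 1; have [j s e] := px 0.
apply: (letter_readable hl (n := n) (x := fun p => x (p%:Z - r'%:Z)) (j := j)
  (t := fun q => if q is 0%N then j0 else j1)) => //.
- by case.
- move=> [|[|//]] p _ ph; last by rewrite -e1//; congr (x _); lia.
  by rewrite -e0//; congr (x _); lia.
- by move=> p ph; rewrite -e//; congr (x _); lia.
- by lia.
Qed.

Lemma parsed_shift n r x :
  parsed n r x -> parsed n (r.+1 %% height n) (shift_map x).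
Proof.
move=> px q; have [j sj jE] := px (q + (r.+1 %/ height n)%:Z).
exists j => // p ph; rewrite -jE// /shift_map; congr (x _).
have := divn_eq r.+1 (height n); nia.
Qed.

(** A move by at most [height n] changes the block by at most one, and the margins in [good] allow
    for this on both sides. *)
Lemma good_bounds n r i : good n r -> `|i| <= (height n)%:Z ->
  exists2 q, r%:Z + i = q%:Z &
    (q < height n.+1)%N /\ (nwords n.+1 + 2 <= q %/ height n)%N.
Proof.
move=> /andP[g1 g2] ih; have := divn_eq r (height n).
have := ltn_pmod r (height_gt0 n).
move: (r %/ _)%N (r %% _)%N g1 g2 => d m g1 g2 mh rE.
have h0 := height_gt0 n.
have ri : (nwords n.+1 + 2)%:Z * (height n)%:Z <= r%:Z + i by nia.
exists `|(r%:Z + i)%R|%N; first by nia.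
split; first by rewrite heightS; nia.
by rewrite leq_divRL//; nia.
Qed.

Lemma letter_common n j j' p : (nwords n.+1 + 2 <= p %/ height n)%N ->
  letter n.+1 j p = letter n.+1 j' p.
Proof. by move=> ph /=; rewrite (block_type_common l j j' ph). Qed.

(** The letter lies in the common part, so the unknown word containing the origin may be replaced by
    word 0. *)
Lemma good_parsed n r i x : good n r -> parsed n.+1 r x ->
  `|i| <= (height n)%:Z -> x i = letter n.+1 0 `|(r%:Z + i)%R|%N.
Proof.
move=> gr px ih; have [q qE [qh qs]] := good_bounds gr ih.
have [j sj jE] := px 0; rewrite qE absz_nat (letter_common 0 j)//.
by rewrite -jE//; congr (x _); lia.
Qed.

Lemma parsed_unique P x x' : good_often P -> (forall n, parsed n (P n) x) ->
  (forall n, parsed n (P n) x') -> x = x'.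
Proof.
move=> gP px px'; apply/funext => i; have [n ni gn] := gP `|i|%N.
have ih : `|i| <= (height n)%:Z by have := height_gt hl n; lia.
by rewrite (good_parsed gn _ ih)// (good_parsed gn _ ih).
Qed.

(** Makes the definition of [x] in [parsed_exists] independent of the chosen level. For [n < n'],
    word 0 of level [n'.+1] has some word of level [n.+1] around this place, and the place is in its
    common part. *)
Lemma good_letter_coherent P n n' i : coherent P ->
  good n (P n.+1) -> good n' (P n'.+1) ->
  `|i| <= (height n)%:Z -> `|i| <= (height n')%:Z ->
  letter n.+1 0 `|((P n.+1)%:Z + i)%R|%N = letter n'.+1 0 `|((P n'.+1)%:Z + i)%R|%N.
Proof.
wlog nn' : n n' / (n <= n')%N => [W|].
  have [nn'|/ltnW nn'] := leqP n n'; first exact: W.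
  by move=> *; apply/esym/W.
move=> cP gn gn' ih ih'.
have [q qE [qh qs]] := good_bounds gn ih.
have [q' q'E [q'h q's]] := good_bounds gn' ih'.
rewrite qE q'E !absz_nat.
move: nn'; rewrite leq_eqVlt => /predU1P[nn'|nn'].
  by move: q'E; rewrite -nn' qE => -[->].
have q'q : q' = ((P n'.+1 %/ height n.+1) * height n.+1 + q)%N.
  have := divn_eq (P n'.+1) (height n.+1).
  rewrite (@coherent_mod _ n.+1)//; [nia|exact: ltnW].
have [j' sj' j'E] :=
  letter_subblock hl 0 (P n'.+1 %/ height n.+1) (nn' : n.+1 < n'.+1)%N.
by rewrite q'q j'E//; exact: letter_common.
Qed.

Lemma parsed_exists P : coherent P -> good_often P ->
  exists x, forall n, parsed n (P n) x.
Proof.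
move=> cP gP.
have /choice[N hN] : forall i : int, exists n,
    `|i| <= (height n)%:Z /\ good n (P n.+1).
  move=> i; have [n ni gn] := gP `|i|%N; exists n; split=> //.
  by have := height_gt hl n; lia.
pose x : bisequence 'I_4 := fun i => letter (N i).+1 0 `|((P (N i).+1)%:Z + i)%R|%N.
have xE n i : good n (P n.+1) -> `|i| <= (height n)%:Z ->
    x i = letter n.+1 0 `|((P n.+1)%:Z + i)%R|%N.
  by move=> gn ih; have [iN gN] := hN i; exact: good_letter_coherent.
exists x => n q.
(* The level [m] is so high that the whole block [q] lies within [height m] of the origin; all its
   letters are then read in word 0 of level [m.+1], where block [Q] is a word of level [n]. *)
have [m + gm] := gP (n + (`|q| + 1) * height n)%N.
move=> mh; have nm : (n < m.+1)%N by lia.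
have hm := height_gt hl m.
have PE := divn_eq (P m.+1) (height n).
rewrite (@coherent_mod _ n) in PE => //; last exact: ltnW.
have Ph := coherent_lt n cP.
have bd p : (p < height n)%N ->
    `|q * (height n)%:Z + p%:Z - (P n)%:Z| <= (height m)%:Z by nia.
pose Q := q + (P m.+1 %/ height n)%:Z.
have pos p : (p < height n)%N ->
    (P m.+1)%:Z + (q * (height n)%:Z + p%:Z - (P n)%:Z) =
    Q * (height n)%:Z + p%:Z.
  by move=> ph; rewrite /Q [in LHS]PE; nia.
have Q0 : 0 <= Q.
  have [r rE _] := good_bounds gm (bd 0%N (height_gt0 n)).
  have := pos 0%N (height_gt0 n); rewrite rE.
  have := height_gt0 n; nia.
have [j sj jE] := letter_subblock hl 0 `|Q|%N nm.
exists j => // p ph; rewrite (xE m)//; last exact: bd.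
rewrite pos// -jE//; congr letter; lia.
Qed.

(** At a high enough good level [n], both ends of the window lie in the word of level [n.+1]
    containing the origin. *)
Lemma parsed_limit P x : good_often P -> (forall n, parsed n (P n) x) ->
  limit_system (words l) x.
Proof.
move=> gP px i m; have [n nim gn] := gP (`|i| + m)%N.
have hn := height_gt hl n.
have [q qE [qh _]] := good_bounds gn (i := i) ltac:(lia).
have [q' q'E [q'h _]] := good_bounds gn (i := i + m%:Z) ltac:(lia).
have [j sj jE] := px n.+1 0.
exists n.+1, (word n.+1 j); split; first by exists j.
apply/infixP; exists (take q (word n.+1 j)), (drop q' (word n.+1 j)).
rewrite -{1}(cat_take_drop q (word n.+1 j)); congr cat.
have -> : q' = (m + q)%N by lia.
rewrite -drop_drop -{1}(cat_take_drop m (drop q (word n.+1 j))); congr cat.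
have sz : size (take m (drop q (word n.+1 j))) = m.
  by rewrite size_takel// size_drop size_word; lia.
apply/(@eq_from_nth _ ord0); rewrite sz ?size_mkseq// => p pm.
rewrite nth_take// nth_drop nth_word; last by lia.
by rewrite nth_mkseq// -jE; [congr (x _); lia|lia].
Qed.

(** Recovers all residues from a sequence, for the description of the image of the coding.
    Uniqueness of parsing makes the residues coherent. *)
Lemma parsed_coherent x :
  (forall N, exists2 n, (N <= n)%N &
     exists r, [/\ (r < height n.+1)%N, good n r & parsed n.+1 r x]) ->
  exists P, [/\ coherent P, good_often P & forall n, parsed n (P n) x].
Proof.
move=> hx.
have /choice[P hP] : forall n, exists r, (r < height n)%N /\ parsed n r x.
  move=> n; have [m nm [r [_ _ rx]]] := hx n.
  exists (r %% height n)%N; rewrite ltn_mod height_gt0; split=> //.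
  by apply: parsed_le rx; exact: leqW.
exists P; split=> [n|N|n]; last by case: (hP n).
  apply: (@parsed_inj n _ _ x); [by rewrite ltn_mod|by case: (hP n)| |by case: (hP n)].
  by apply: parsed_pred; case: (hP n.+1).
have [n Nn [r [rh gr rx]]] := hx N; exists n => //.
by case: (hP n.+1) => ? ?; rewrite -(@parsed_inj n.+1 r (P n.+1) x).
Qed.

(** One good level [m] keeps [P m.+1] from being maximal, so above [m] adding 1 never wraps around.
    It then stays in the same block of level [n], and goodness depends on that block only. *)
Lemma good_often_next P P' : coherent P -> coherent P' -> good_often P ->
  (forall n, P' n = ((P n).+1 %% height n)%N) -> good_often P'.
Proof.
move=> cP cP' gP PP'; have [m _ /andP[_ gm]] := gP 0%N.
have small n : (m < n)%N -> ((P n).+1 < height n)%N.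
  move=> mn; have Pn := coherent_lt n cP; rewrite ltn_neqAle Pn andbT.
  apply/eqP => E; have := dvdn_height l mn.
  rewrite /dvdn -E -addn1 -modnDml (coherent_mod cP mn) addn1 modn_small//.
  have := divn_eq (P m.+1) (height m); have := ltn_pmod (P m.+1) (height_gt0 m).
  by rewrite heightS; nia.
move=> N; have [n Nn gn] := gP (maxn N m.+1); exists n; first by lia.
have Sn := small n.+1 ltac:(lia); have Sn' := small n ltac:(lia).
rewrite PP' modn_small// /good.
suff -> : ((P n.+1).+1 %/ height n = P n.+1 %/ height n)%N by [].
rewrite {1}(divn_eq (P n.+1) (height n)) cP -addnS divnMDl ?height_gt0//.
by rewrite (divn_small Sn') addn0.
Qed.

End Config.

(** * Borel sets of products of discrete spaces *)

HB.instance Definition _ n := isPointed.Build 'I_n.+1 ord0.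

Section ProductOfDiscrete.
Variables (I : eqType) (T : I -> choiceType).
Local Notation PT := (prod_topology (fun i => discrete_topology (T i))).

(** The exhaustion [F] stands for the finite sets of coordinates, which serves both integers and
    naturals. The sets satisfying the conclusion form a filter, whose convergence to [x] is checked
    coordinatewise. *)
Lemma nbhs_prod_discrete (F : nat -> set I) (x : PT) (U : set PT) :
  {homo F : m n / (m <= n)%N >-> m `<=` n} -> (forall i, exists m, F m i) ->
  nbhs x U -> exists m, forall y : PT, (forall i, F m i -> y i = x i) -> U y.
Proof.
move=> mF cF.
pose G : set_system PT :=
  [set A | exists m, forall y : PT, (forall i, F m i -> y i = x i) -> A y].
have FG : Filter G.
  split=> [|A B [m mA] [n nB]|A B AB [m mA]].
  - by exists 0%N.
  - exists (maxn m n) => y yx; split.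
      by apply: mA => i mi; apply: yx; apply: mF mi; exact: leq_maxl.
    by apply: nB => i ni; apply: yx; apply: mF ni; exact: leq_maxr.
  - by exists m => y /mA; exact: AB.
suff Gx : G --> x by move=> Ux; exact: Gx.
apply/cvg_sup => i A /= [_ [[B oB <-] Bx] BA].
have [m mi] := cF i; exists m => y yx; apply: BA => /=.
by rewrite yx.
Qed.

Lemma open_prod_discrete i (a : T i) : open ([set x | x i = a] : set PT).
Proof.
apply: (@open_comp PT _ (fun x => x i) [set a]) => [f _|].
  exact: (@proj_continuous I (fun i => discrete_topology (T i)) i).
exact: discrete_open.
Qed.

End ProductOfDiscrete.

Lemma open_bigcup_basis (T : topologicalType) (J : Type) (B : J -> set T)
    (U : set T) :
  (forall x V, nbhs x V -> exists2 j, B j x & B j `<=` V) -> open U ->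
  U = \bigcup_j (if `[< B j `<=` U >] then B j else set0).
Proof.
move=> nB oU; apply/seteqP; split=> [x Ux|x [j _]].
  have [j Bx BU] := nB x U (open_nbhs_nbhs (conj oU Ux)).
  by exists j => //; rewrite asboolT.
by case: asboolP => // BU /BU.
Qed.

Lemma sigma_open_basis (T : ptopologicalType) (J : countType) (B : J -> set T) :
  (forall j, open (B j)) ->
  (forall x V, nbhs x V -> exists2 j, B j x & B j `<=` V) ->
  <<s @open T >> = <<s range B >>.
Proof.
move=> oB nB; apply/seteqP; split.
  apply: smallest_sub; first exact: smallest_sigma_algebra.
  move=> U oU; rewrite (open_bigcup_basis nB oU).
  apply: (@countable_bigcupT_measurable _ (g_sigma_algebraType (range B))) => // j.
  case: asboolP => _; last exact: measurable0.
  by apply: sub_gen_smallest; exists j.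
apply: smallest_sub; first exact: smallest_sigma_algebra.
by move=> _ [j _ <-]; apply: sub_gen_smallest; exact: oB.
Qed.

Section Bisequence.
Variable S : pointedFinType.
Implicit Types (x : bisequence S).

Lemma open_letter (i : int) (a : S) : open ([set x | x i = a] : set (bisequence S)).
Proof. exact: (@open_prod_discrete int (fun=> S)). Qed.

(** The window is the interval from [- m] to [m]; letters missing from a short word are read as
    [point]. The indices form a countable type. *)
Definition central_cylinder (mu : nat * seq S) : set (bisequence S) :=
  \bigcap_(p < mu.1.*2.+1) [set x | x (p%:Z - mu.1%:Z) = nth point mu.2 p].

Lemma nbhs_cylinder x (V : set (bisequence S)) : nbhs x V ->
  exists2 mu, central_cylinder mu x & central_cylinder mu `<=` V.
Proof.
move=> /(@nbhs_prod_discrete int (fun=> S) (fun m => [set i : int | (`|i| <= m)%N])).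
case=> [m n mn i /= im|i|m xV]; [exact: leq_trans mn|by exists `|i|%N => /=|].
exists (m, mkseq (fun p => x (p%:Z - m%:Z)) m.*2.+1) => [p/= pm|y yx].
  by rewrite nth_mkseq.
apply: xV => i /= im; have pm : (`|(i + m%:Z)%R| < m.*2.+1)%N by lia.
have := yx _ pm; rewrite /= nth_mkseq//.
by have -> : `|(i + m%:Z)%R|%N%:Z - m%:Z = i by lia.
Qed.

Lemma open_cylinder mu : open (central_cylinder mu).
Proof.
rewrite /central_cylinder bigcap_mkord.
by apply: big_ind => [|A B|i _]; [exact: openT|exact: openI|exact: open_letter].
Qed.

Lemma sigma_bisequence :
  <<s @open (bisequence S) >> = <<s range central_cylinder >>.
Proof. exact: (sigma_open_basis open_cylinder nbhs_cylinder). Qed.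

Lemma measurable_letter (i : int) (a : S) :
  measurable ([set x | x i = a] : set (borel (bisequence S))).
Proof. by apply: sub_gen_smallest; exact: open_letter. Qed.

Lemma measurable_fun_bisequence d (X : measurableType d)
    (f : X -> borel (bisequence S)) :
  (forall (i : int) (a : S), measurable [set y | f y i = a]) ->
  measurable_fun setT f.
Proof.
move=> mf; apply: (@measurability _ _ X (borel (bisequence S)) _ f
  (range central_cylinder)).
  exact: sigma_bisequence.
move=> _ [_ [[m u] _ <-] <-].
rewrite setTI preimage_bigcap; apply: bigcap_measurableType.
by move=> i _; exact: mf.
Qed.

End Bisequence.

(** * Positions in the odometer *)

Lemma Zp_eqN1 p (z : 'Z_p) : (1 < p)%N -> (z == -1) = (val z == p.-1).
Proof.
case: p z => [|[|p]] // z _.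
by rewrite -val_eqE /= (@modn_small 1)// subn1 modn_small.
Qed.

Lemma val_Zp_add1 p (z : 'Z_p) : (1 < p)%N -> val (z + 1) = ((val z).+1 %% p)%N.
Proof.
by case: p z => [|[|p]] // z _; rewrite /= (@modn_small 1)// addn1.
Qed.

Section Odometer.
Variable k : nat -> nat.
Hypothesis hk : forall n, (2 <= k n)%N.
Implicit Types (y : odometer_space k) (n m r : nat).

Definition base n := (\prod_(i < n) k i)%N.

Definition digit y n : nat := val (y n : 'Z_(k n)).

(** The mixed radix value of the first [n] digits, least significant first. *)
Definition position n y := (\sum_(i < n) digit y i * base i)%N.

Lemma base0 : base 0 = 1%N. Proof. by rewrite /base big_ord0. Qed.

Lemma baseS n : base n.+1 = (base n * k n)%N.
Proof. by rewrite /base big_ord_recr. Qed.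

Lemma base_gt0 n : (0 < base n)%N.
Proof. by apply: prodn_gt0 => i; apply: leq_trans (hk i). Qed.

Lemma dvdn_base m n : (m <= n)%N -> (base m %| base n)%N.
Proof.
move=> /subnK <-; elim: (n - m)%N => [|d IH] //.
by rewrite addSn baseS dvdn_mulr.
Qed.

Lemma digit_lt y n : (digit y n < k n)%N.
Proof. by rewrite /digit -[X in (_ < X)%N](Zp_cast (hk n)) ltn_ord. Qed.

Lemma positionS n y : position n.+1 y = (digit y n * base n + position n y)%N.
Proof. by rewrite /position big_ord_recr addnC. Qed.

Lemma position_lt n y : (position n y < base n)%N.
Proof.
elim: n => [|n IH]; first by rewrite /position big_ord0 base_gt0.
by rewrite positionS baseS; have := digit_lt y n; nia.
Qed.

Lemma position_mod m n y : (m <= n)%N -> (position n y %% base m)%N = position m y.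
Proof.
move=> /subnK <-; elim: (n - m)%N => [|d IH].
  by rewrite add0n modn_small// position_lt.
rewrite addSn positionS -IH.
have /dvdnP[c ->] := dvdn_base (leq_addl d m).
by rewrite mulnA modnMDl.
Qed.

Lemma digitE n y : digit y n = (position n.+1 y %/ base n)%N.
Proof. by rewrite positionS divnMDl ?base_gt0// divn_small ?addn0// position_lt. Qed.

Lemma digit_inj y y' n : digit y n = digit y' n -> y n = y' n.
Proof. by move=> e; apply: val_inj. Qed.

Lemma position_eqP n y y' :
  position n y = position n y' <-> forall i, (i < n)%N -> y i = y' i.
Proof.
split=> [e i ni|e].
  by apply: digit_inj; rewrite !digitE -!(position_mod _ ni) e.
by apply: eq_bigr => i _; rewrite /digit e.
Qed.

Definition expansion r : odometer_space k := fun i => inZp (r %/ base i) : 'Z_(k i).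

Lemma digit_expansion r n : digit (expansion r) n = ((r %/ base n) %% k n)%N.
Proof. by rewrite /digit /= Zp_cast. Qed.

Lemma position_expansion n r : position n (expansion r) = (r %% base n)%N.
Proof.
elim: n => [|n IH]; first by rewrite /position big_ord0 base0 modn1.
rewrite positionS IH digit_expansion baseS.
have e := divn_eq r (base n); have e' := divn_eq (r %/ base n) (k n).
have cb := ltn_pmod r (base_gt0 n).
have dk := ltn_pmod (r %/ base n) (leq_trans (ltn0Sn 1) (hk n)).
move: e e' cb dk; set c := (r %% _)%N; set d := (_ %% k n)%N => e e' cb dk.
have -> : r = (r %/ base n %/ k n * (base n * k n) + (d * base n + c))%N.
  by rewrite {1}e {1}e'; lia.
by rewrite modnMDl modn_small//; nia.
Qed.

Lemma digit_max y n : ((y n : 'Z_(k n)) == -1) = (digit y n == (k n).-1).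
Proof. exact: Zp_eqN1. Qed.

Lemma position_max n y :
  [forall i : 'I_n, (y i : 'Z_(k i)) == -1] = ((position n y).+1 == base n).
Proof.
elim: n => [|n IH].
  by rewrite /position big_ord0 base0 eqxx; apply/forallP => -[].
have -> : [forall i : 'I_n.+1, (y i : 'Z_(k i)) == -1] =
    [forall i : 'I_n, (y i : 'Z_(k i)) == -1] && ((y n : 'Z_(k n)) == -1).
  apply/forallP/andP => [h|[/forallP h hn] [i /= ]].
    split; last exact: (h ord_max).
    by apply/forallP => i; exact: (h (widen_ord (leqnSn n) i)).
  rewrite ltnS leq_eqVlt => /predU1P[->//|ni].
  exact: (h (Ordinal ni)).
rewrite IH digit_max positionS baseS.
have := position_lt n y; have := digit_lt y n; have := base_gt0 n.
by move=> *; apply/andP/eqP => [[/eqP ? /eqP ?]|?]; [nia|split; apply/eqP; nia].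
Qed.

Lemma digit_map y n : digit (odometer_map y) n =
  if (position n y).+1 == base n then ((digit y n).+1 %% k n)%N else digit y n.
Proof.
by rewrite /digit /odometer_map position_max; case: ifP => // _; exact: val_Zp_add1.
Qed.

(** Digit [n] receives a carry exactly when the residue modulo [base n] wraps to 0, by
    [position_max]. *)
Lemma position_map n y :
  position n (odometer_map y) = ((position n y).+1 %% base n)%N.
Proof.
elim: n => [|n IH]; first by rewrite /position !big_ord0 base0 modn1.
rewrite positionS IH digit_map.
have b0 := base_gt0 n; have pl := position_lt n y; have dl := digit_lt y n.
case: eqP => [e|ne].
  rewrite e modnn addn0 positionS -addnS e -mulSnr baseS.
  by rewrite [(base n * _)%N]mulnC muln_modl.
rewrite (@modn_small (position n y).+1); last lia.
rewrite addnS -positionS modn_small// positionS baseS; nia.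
Qed.

Lemma open_digit n (a : 'Z_(k n)) :
  open ([set y | (y n : 'Z_(k n)) = a] : set (odometer_space k)).
Proof. exact: (@open_prod_discrete nat (fun n => 'Z_(k n))). Qed.

Definition odometer_cylinder (nr : nat * nat) : set (odometer_space k) :=
  [set y | position nr.1 y = nr.2].

Lemma nbhs_odometer_cylinder y (V : set (odometer_space k)) : nbhs y V ->
  exists2 n, odometer_cylinder (n, position n y) y &
    odometer_cylinder (n, position n y) `<=` V.
Proof.
move=> /(@nbhs_prod_discrete nat (fun n => 'Z_(k n)) (fun n => `I_n)).
case=> [m n mn i /= im|i|n nV]; [exact: leq_trans mn|by exists i.+1 => /=|].
by exists n => // y' /position_eqP yy'; apply: nV => i /yy'.
Qed.

Lemma open_odometer_cylinder nr : open (odometer_cylinder nr).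
Proof.
case: nr => n r.
have [[y0 y0r]|no] := pselect (exists y, odometer_cylinder (n, r) y); last first.
  rewrite (_ : odometer_cylinder _ = set0); first exact: open0.
  by apply/seteqP; split=> // y yr; apply: no; exists y.
have -> : odometer_cylinder (n, r) =
    \bigcap_(i < n) [set y | (y i : 'Z_(k i)) = y0 i].
  move: y0r; rewrite /odometer_cylinder /= => <-; apply/seteqP; split=> y.
    by move=> /position_eqP h i /h.
  by move=> h; apply/position_eqP => i /h.
rewrite bigcap_mkord.
by apply: big_ind => [|A B|i _]; [exact: openT|exact: openI|exact: open_digit].
Qed.

End Odometer.

(** * Grouping the coordinates into levels; invariance of the measure *)

Section Grouping.
Variable k : nat -> nat.
Hypothesis hk : forall n, (2 <= k n)%N.
Implicit Types (y : odometer_space k) (n m r : nat).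

(* The coefficient [l_n] is the product of the [k_i] for [start n <= i < start n.+1];
   as all [k_i >= 2] it is at least 2 to the number of factors. *)
Fixpoint start n : nat :=
  if n is m.+1 then (start m + nwords m * (nwords m.+1 + 5))%N else 0%N.

Definition coeff n := (\prod_(start n <= i < start n.+1) k i)%N.

Definition level_position n y := position (start n) y.

Lemma leq_start m n : (m <= n)%N -> (start m <= start n)%N.
Proof.
move=> /subnK <-; elim: (n - m)%N => [|d IH] //.
by rewrite addSn (leq_trans IH)//= leq_addr.
Qed.

Lemma start_ge n : (n <= start n)%N.
Proof.
elim: n => // n IH /=; have := nwords_ge4 n; have := nwords_ge4 n.+1.
by move: IH; case: (nwords n) => // s; nia.
Qed.

Lemma coeff_large n : (nwords n * (nwords n.+1 + 5) <= coeff n)%N.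
Proof.
apply: (@leq_trans (2 ^ (nwords n * (nwords n.+1 + 5)))).
  by apply/ltnW/ltn_expl.
rewrite -[X in (2 ^ X)%N](addKn (start n)) -prod_nat_const_nat.
by rewrite /coeff; apply: leq_prod => i _; exact: hk.
Qed.

Lemma height_coeff n : height coeff n = base k (start n).
Proof.
elim: n => [|n IH]; first by rewrite height0 base0.
rewrite heightS IH /coeff /base -!(big_mkord xpredT) mulnC.
rewrite -big_cat_nat//=; exact: (leq_start (leqnSn n)).
Qed.

Lemma level_position_lt n y : (level_position n y < height coeff n)%N.
Proof. by rewrite height_coeff position_lt. Qed.

Lemma coherent_level_position y : coherent coeff (level_position^~ y).
Proof. by move=> n; rewrite height_coeff position_mod// (leq_start (leqnSn n)). Qed.

Lemma level_position_map n y : level_position n (odometer_map y) =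
  ((level_position n y).+1 %% height coeff n)%N.
Proof. by rewrite height_coeff -position_map. Qed.

Lemma level_position_inj y y' :
  (forall n, level_position n y = level_position n y') -> y = y'.
Proof.
move=> e; apply/functional_extensionality_dep => i.
have /(position_eqP hk) := e i.+1; apply.
by rewrite (leq_trans (ltnSn i))// start_ge.
Qed.

Lemma level_position_onto (P : nat -> nat) : coherent coeff P ->
  exists y, forall n, level_position n y = P n.
Proof.
move=> cP; have hl := coeff_large.
have Pmod m n : (m <= n)%N -> (P n %% base k (start m))%N = P m.
  by move=> mn; rewrite -height_coeff coherent_mod.
(* Digit [i] can be read from [P i.+1], which is a residue modulo [base k (start i.+1)] with
   [i < start i.+1]. *)
exists (fun i => expansion k (P i.+1) i) => n.
rewrite -[RHS](Pmod n n)// -position_expansion//.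
apply/position_eqP => // i ni; set N := maxn n i.+1.
have := position_eqP hk i.+1 (expansion k (P i.+1)) (expansion k (P n)).
move=> [+ _]; apply; rewrite // !position_expansion//.
have iS : (i.+1 <= start i.+1)%N := start_ge _.
rewrite -(Pmod i.+1 N) ?leq_maxr// -(Pmod n N) ?leq_maxl//.
by rewrite !modn_dvdm// dvdn_base.
Qed.

(* Empty when [nr.2 >= height nr.1]: this makes the cylinders a pi-system. *)
Definition level_cylinder (nr : nat * nat) : set (odometer_space k) :=
  [set y | level_position nr.1 y = nr.2].

Lemma sigma_odometer :
  <<s @open (odometer_space k) >> = <<s range level_cylinder >>.
Proof.
apply: sigma_open_basis => [[n r]|y V /(nbhs_odometer_cylinder hk)[n yn nV]].
  exact: (open_odometer_cylinder hk (start n, r)).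
exists (n, level_position n y) => // y' e; apply: nV.
rewrite /odometer_cylinder /= -(position_mod hk y (start_ge n)).
by rewrite -(position_mod hk y' (start_ge n)); congr (_ %% _)%N.
Qed.

Lemma measurable_level n r :
  measurable ([set y | level_position n y = r] : set (borel (odometer_space k))).
Proof.
by apply: sub_gen_smallest; exact: (open_odometer_cylinder hk (start n, r)).
Qed.

(** Two cylinders are nested or disjoint; the empty intersection is the cylinder of the impossible
    residue [height coeff n']. *)
Lemma level_cylinderI : setI_closed (range level_cylinder).
Proof.
have W n n' r r' : (n <= n')%N ->
    range level_cylinder (level_cylinder (n, r) `&` level_cylinder (n', r')).
  move=> nn'; have [rr'|rr'] := eqVneq (r' %% height coeff n)%N r.
    exists (n', r') => //; apply/seteqP; split=> [y e|y []//]; split=> //.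
    move: e; rewrite /level_cylinder /= => e.
    by rewrite -rr' -e (coherent_mod coeff_large (coherent_level_position y)).
  exists (n', height coeff n') => //; apply/seteqP; split=> y /=.
    by have := level_position_lt n' y; rewrite /level_cylinder/= => + e; lia.
  rewrite /level_cylinder/= => -[e e']; case/eqP: rr'.
  by rewrite -e -e' (coherent_mod coeff_large (coherent_level_position y)).
move=> _ _ [[n r] _ <-] [[n' r'] _ <-].
have [nn'|/ltnW nn'] := leqP n n'; first exact: W.
by rewrite setIC; exact: W.
Qed.

Lemma measurable_odometer_map :
  measurable_fun setT
    (@odometer_map k : borel (odometer_space k) -> borel (odometer_space k)).
Proof.
apply: (@measurability _ _ (borel (odometer_space k)) (borel (odometer_space k))
  _ _ (range level_cylinder)); first exact: sigma_odometer.
move=> _ [_ [[n r] _ <-] <-]; rewrite setTI.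
rewrite (_ : _ @^-1` _ = \bigcup_(m in [set m | (m.+1 %% height coeff n)%N = r])
   [set y | level_position n y = m]); last first.
  apply/seteqP; split=> y; rewrite /level_cylinder/= level_position_map.
    by move=> e; exists (level_position n y).
  by move=> [m /= e ->].
by apply: bigcup_measurable => m _; exact: measurable_level.
Qed.

Section Measure.
Variables (R : realType) (mu : probability (borel (odometer_space k)) R).
Hypothesis hmu : uniform_product mu.

Lemma measure_level n r : (r < height coeff n)%N ->
  mu [set y | level_position n y = r] = ((height coeff n)%:R^-1)%:E.
Proof.
rewrite height_coeff => rb; set N := start n in rb *.
pose A i : {set 'Z_(k i)} := [set expansion k r i : 'Z_(k i)]%SET.
have -> : [set y | level_position n y = r] =
    [set y : odometer_space k | forall i, (i < N)%N -> (y i : 'Z_(k i)) \in A i].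
  apply/seteqP; split=> y /=.
    rewrite -[X in _ = X -> _](modn_small rb) -position_expansion//.
    by move=> /(position_eqP hk) e i /e ->; rewrite finset.inE.
  move=> yA; rewrite -(modn_small rb) -position_expansion//.
  by apply/(position_eqP hk) => i /yA; rewrite finset.inE => /eqP.
rewrite hmu; congr (_%:E); rewrite /base natr_prod -prodfV.
by apply: eq_bigr => i _; rewrite cards1 mul1r.
Qed.

(** The map permutes the cylinders of each level, which have equal mass; the cylinders form a
    generating pi-system. *)
Lemma odometer_map_invariant : invariant_measure mu (@odometer_map k).
Proof.
move=> E mE.
pose f : {mfun borel (odometer_space k) >-> borel (odometer_space k)} :=
  HB.pack (@odometer_map k) (isMeasurableFun.Build _ _ _ _ _ measurable_odometer_map).
have setT_level : range level_cylinder setT.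
  exists (0, 0)%N => //; apply/seteqP; split=> // y _.
  by have := level_position_lt 0 y; rewrite /level_cylinder/= height0; lia.
apply: (@g_sigma_algebra_measure_unique _ R (borel (odometer_space k))
  (range level_cylinder) _ (fun=> setT) _ _ (distribution mu f) mu) => //.
- by move=> _ [[n r] _ <-]; exact: measurable_level.
- exact: bigcup_const.
- exact: level_cylinderI.
- move=> _ [[n r] _ <-].
  transitivity (mu (@odometer_map k @^-1` level_cylinder (n, r))) => //.
  have [hr|rh] := leqP (height coeff n) r.
    rewrite (_ : level_cylinder _ = set0) ?preimage_set0 ?measure0//.
    apply/seteqP; split=> // y; rewrite /level_cylinder /= => e.
    by have := level_position_lt n y; lia.
  (* This residue is [r - 1], written without a subtraction that would truncate at [r = 0]. *)
  rewrite (_ : _ @^-1` _ = [set y | level_position n y =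
      ((r + (height coeff n).-1) %% height coeff n)%N]); last first.
    apply/seteqP; split=> y; rewrite /level_cylinder /= level_position_map;
      have := level_position_lt n y; move: (level_position n y) => p ph.
      move=> <-; rewrite -modnDml modn_mod modnDml.
      by rewrite addSnnS prednK ?modnDr ?modn_small//; lia.
    move=> ->; rewrite -addn1 modnDml -addnA addn1 prednK; last lia.
    by rewrite modnDr modn_small.
  have h0 : (0 < height coeff n)%N by lia.
  by rewrite measure_level ?ltn_mod//; apply/esym/measure_level.
- by move=> _; rewrite [X in (X < _)%E](probability_setT (distribution mu f)) ltry.
- by rewrite -sigma_odometer.
Qed.

End Measure.
End Grouping.

(** * Almost every point is good infinitely often *)

Section BadPositions.
Variable l : nat -> nat.
Hypothesis hl : forall n, (nwords n * (nwords n.+1 + 5) <= l n)%N.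
Local Notation height := (height l).
Local Notation good := (good l).

Definition bad_between m n r :=
  all (fun i => ~~ good i (r %% height i.+1)) (iota m (n - m)).

(** The bad blocks are the first [nwords n.+1 + 3] and the last one. *)
Lemma card_bad_digits n :
  (#|[set d : 'I_(l n) | ~~ good n (d * height n)]%SET| * 2 <= l n)%N.
Proof.
have h0 := height_gt0 hl n; have := hl n; have s4 := nwords_ge4 n.
suff : (#|[set d : 'I_(l n) | ~~ good n (d * height n)]%SET| <= nwords n.+1 + 4)%N.
  by nia.
pose f d := (if d < nwords n.+1 + 3 then d else nwords n.+1 + 3)%N.
apply: (card_le_inj (f := f)); rewrite /f.
  by move=> d _; case: ifP; lia.
move=> d e; rewrite !finset.inE /good !mulnK// => bd be.
move=> E; apply: val_inj => /=; have := ltn_ord d; have := ltn_ord e.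
by move: bd be E; do 2 case: ifP; lia.
Qed.

(** Writing [r] as remainder and quotient by [height M], goodness at level [M] depends on the
    quotient only and at lower levels on the remainder only. The counts multiply, each level halving
    the proportion. *)
Lemma card_bad_between m d :
  (#|[set r : 'I_(height (m + d)) | bad_between m (m + d) r]%SET| * 2 ^ d <=
   height (m + d))%N.
Proof.
elim: d => [|d IH].
  by rewrite expn0 muln1 (leq_trans (max_card _))// card_ord.
set M := (m + d)%N in IH *; rewrite addnS -/M.
have h0 := height_gt0 hl M.
have rl (r : 'I_(height M.+1)) : (r %/ height M < l M)%N.
  by rewrite ltn_divLR// -heightS.
have rh (r : 'I_(height M.+1)) : (r %% height M < height M)%N by rewrite ltn_mod.
pose f r := (Ordinal (rh r), Ordinal (rl r)).
have f_inj : injective f.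
  move=> r r' [e e']; apply: val_inj => /=.
  by rewrite (divn_eq r (height M)) e e' -divn_eq.
set B := [set r : 'I_(height M.+1) | _]%SET.
set B' := [set r : 'I_(height M) | _]%SET in IH.
set D := [set d : 'I_(l M) | ~~ good M (d * height M)]%SET.
have BD : (#|B| <= #|finset.setX B' D|)%N.
  rewrite -(card_imset _ f_inj); apply/subset_leq_card/fintype.subsetP => p.
  case/imsetP => r; rewrite finset.inE /bad_between => + ->.
  rewrite subSn; last exact: leq_addr.
  rewrite -[(M - m).+1]addn1 iotaD all_cat subnKC ?leq_addr//= andbT => /andP[bad badM].
  rewrite !finset.inE /=; apply/andP; split.
    apply/allP => i iM; move/allP: bad => /(_ i iM).
    rewrite modn_dvdm//; apply: dvdn_height.
    by move: iM; rewrite mem_iota; lia.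
  move: badM; rewrite /good mulnK// modn_small//.
have := card_bad_digits M; rewrite -/D => cD.
rewrite cardsX in BD; rewrite [leqRHS]heightS expnS.
by move: BD IH cD; nia.
Qed.

End BadPositions.

(** * Full measure of the points with infinitely many good levels *)

Section Null.
Variable k : nat -> nat.
Hypothesis hk : forall n, (2 <= k n)%N.
Variables (R : realType) (mu : probability (borel (odometer_space k)) R).
Hypothesis hmu : uniform_product mu.
Let l := coeff k.
Let hl := coeff_large hk.
Local Notation P := (@level_position k).

Definition often_good : set (borel (odometer_space k)) :=
  [set y | good_often l (fun n => P n y)].

Lemma measurable_good n :
  measurable [set y : borel (odometer_space k) | good l n (P n.+1 y)].
Proof.
rewrite (_ : [set y | _] = \bigcup_(r in [set r | good l n r])
    [set y | P n.+1 y = r]).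
  by apply: bigcup_measurable => r _; exact: measurable_level.
by apply/seteqP; split=> [y gy|y [r gr /= ->]]; [exists (P n.+1 y)|].
Qed.

Lemma often_goodE : often_good =
  \bigcap_N \bigcup_(n in [set n | (N <= n)%N]) [set y | good l n (P n.+1 y)].
Proof.
apply/seteqP; split=> y h N; last by have [n Nn gn] := h N I; exists n.
by move=> _; have [n Nn gn] := h N; exists n.
Qed.

Lemma measurable_often_good : measurable often_good.
Proof.
rewrite often_goodE; apply: bigcapT_measurable => N.
by apply: bigcup_measurable => n _; exact: measurable_good.
Qed.

Let bad_from N : set (borel (odometer_space k)) :=
  \bigcap_(n in [set n | (N <= n)%N]) ~` [set y | good l n (P n.+1 y)].

Let measurable_bad_from N : measurable (bad_from N).
Proof.
apply: bigcap_measurable => [|n _]; first by exists N => /=.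
by apply: measurableC; exact: measurable_good.
Qed.

(** Badness at the [d] levels from [N] on is decided by the residue at level [N + d], and residues
    are equidistributed. *)
Lemma measure_bad_le N d :
  (mu (bad_from N) <= (2^-1 ^+ d)%:E)%E.
Proof.
set M := (N + d)%N.
pose F (r : 'I_(height l M)) : set (borel (odometer_space k)) :=
  [set y | P M y = r].
have mF r : measurable (F r) by exact: measurable_level.
set B := [pred r : 'I_(height l M) | bad_between l N M r].
apply: (@le_trans _ _ (mu (\big[setU/set0]_(r in B) F r))).
  apply: le_measure; rewrite ?inE.
  - exact: measurable_bad_from.
  - by apply: bigsetU_measurable => r _; exact: mF.
  - move=> y bad; rewrite -bigcup_pred.
    exists (Ordinal (level_position_lt hk M y)) => //.
    apply/allP => i; rewrite mem_iota => iNM.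
    have := bad i; rewrite /= => /(_ ltac:(lia))/negP.
    by rewrite (coherent_mod hl (coherent_level_position hk y))//; lia.
have -> : mu (\big[setU/set0]_(r in B) F r) = (\sum_(r in B) mu (F r))%E.
  apply: measure_bigsetU_ord_cond => [r _|]; first exact: mF.
  apply/trivIsetP => r r' _ _ /eqP rr'; apply/seteqP; split=> // y [] /= yr yr'.
  by apply: rr'; apply: val_inj; rewrite /= -yr -yr'.
rewrite (eq_bigr (fun=> ((height l M)%:R^-1)%:E)); last first.
  by move=> r _; exact: measure_level.
rewrite sumEFin lee_fin sumr_const -[_ *+ _]mulr_natl.
have h0 : 0 < (height l M)%:R :> R by rewrite ltr0n height_gt0.
rewrite ler_pdivrMr// -ler_pdivrMl ?exprn_gt0// exprVn invrK mulrC -natrX -natrM.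
rewrite ler_nat.
have := card_bad_between hl N d.
by rewrite (_ : #|_| = #|B|)// cardsE.
Qed.

Lemma measure_often_good : mu often_good = 1%E.
Proof.
have mC : measurable (~` often_good).
  by apply: measurableC; exact: measurable_often_good.
rewrite -(setCK often_good) probability_setC//.
suff -> : mu (~` often_good) = 0%E by rewrite sube0.
apply: measure_negligible => //; rewrite often_goodE setC_bigcap.
apply: negligible_bigcup => N; rewrite setC_bigcup -/(bad_from N).
have mZ := measurable_bad_from N; set Z := bad_from N in mZ *.
apply/negligibleP => //; apply/eqP; rewrite eq_le measure_ge0 andbT.
rewrite leNgt; apply/negP => Z0.
have := fin_num_measure mu _ mZ => /fineK ZE.
pose e := fine (mu Z); have e0 : 0 < e by move: Z0; rewrite -ZE lte_fin.
(* Then [e^-1 < d < 2 ^ d], so the bound of [measure_bad_le] falls below [e]. *)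
pose d := (Num.truncn e^-1).+1.
have := measure_bad_le N d; rewrite -/Z -ZE lee_fin -/e exprVn => ed.
have : e^-1 < (2 ^ d)%:R.
  by apply: lt_trans (truncnS_gt _) _; rewrite ltr_nat ltn_expl.
rewrite natrX -[X in _ < X]invrK ltf_pV2 ?posrE// ?invr_gt0 ?exprn_gt0//.
by move=> /lt_le_trans/(_ ed); rewrite ltxx.
Qed.

End Null.

(** * The isomorphism *)

Lemma measurable_window (S : pointedFinType) (i : int) (m : nat) (u : seq S) :
  measurable [set x : borel (bisequence S) |
    mkseq (fun j => x (i + j%:Z) : S) m = u].
Proof.
have [um|um] := eqVneq (size u) m; last first.
  rewrite (_ : [set x | _] = set0); first exact: measurable0.
  by apply/seteqP; split=> // x /= xu; case/eqP: um; rewrite -xu size_mkseq.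
rewrite (_ : [set x | _] =
    \bigcap_(j in `I_m) [set x : borel (bisequence S) | x (i + j%:Z) = nth point u j]).
  by apply: bigcap_measurableType => j _; exact: measurable_letter.
apply/seteqP; split=> x /=.
  by move=> <- j /= jm; rewrite nth_mkseq.
move=> xu; apply: (@eq_from_nth _ point); rewrite size_mkseq// => j jm.
by rewrite nth_mkseq//; exact: xu.
Qed.

Lemma countable_bigcapT_measurable d (T : measurableType d) (J : countType)
    (F : J -> set T) :
  (forall j, measurable (F j)) -> measurable (\bigcap_j F j).
Proof.
move=> mF; rewrite -[X in measurable X]setCK setC_bigcap; apply: measurableC.
by apply: countable_bigcupT_measurable => // j; exact: measurableC.
Qed.

Lemma measurable_limit_system (S : pointedFinType) (W : nat -> set (seq S)) :
  measurable (limit_system W : set (borel (bisequence S))).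
Proof.
pose L : set (seq S) := [set u | exists n w, W n w /\ infix u w].
rewrite (_ : limit_system W = \bigcap_i \bigcap_m \bigcup_u
    (if `[< L u >] then [set x : borel (bisequence S) |
       mkseq (fun j => x ((i : int) + j%:Z) : S) m = u] else set0)).
  apply: countable_bigcapT_measurable => i; apply: bigcapT_measurable => m.
  apply: countable_bigcupT_measurable => // u.
  by case: ifP => _; [exact: measurable_window|exact: measurable0].
apply/seteqP; split=> x Lx i.
  move=> _ m _; exists (mkseq (fun j => x (i + j%:Z) : S) m) => //.
  by rewrite asboolT//; exact: Lx.
by move=> m; have [u _] := Lx i I m I; case: asboolP => // Lu /= ->.
Qed.

Lemma measurable_shift (S : pointedFinType) (E : set (borel (bisequence S))) :
  measurable E -> measurable (@shift_map S @^-1` E : set (borel (bisequence S))).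
Proof.
move=> mE; rewrite -[X in measurable X]setTI.
apply: (@measurable_fun_bisequence S _ (borel (bisequence S)) (@shift_map S)) => // i a.
exact: measurable_letter.
Qed.

(** * The coding map and its image *)

Section Coding.
Variable k : nat -> nat.
Hypothesis hk : forall n, (2 <= k n)%N.
Let l := coeff k.
Let hl := coeff_large hk.
Local Notation P := (@level_position k).
Local Notation X := (borel (odometer_space k)).
Local Notation Y := (borel (bisequence 'I_4)).
Local Notation A := (@often_good k).

(** Off the full set [A] the value is constant, which keeps the map total and measurable. *)
Definition coding (y : X) : Y :=
  if `[< A y >] then xget point [set x | forall n, parsed l n (P n y) x]
  else point.

Lemma parsed_coding y : A y -> forall n, parsed l n (P n y) (coding y).
Proof.
move=> Ay; rewrite /coding asboolT//.
have [x px] := parsed_exists hl (coherent_level_position hk y) Ay.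
exact: (@xgetPex _ point [set x | forall n, parsed l n (P n y) x] (ex_intro _ x px)).
Qed.

Lemma coding_unique y (x : Y) : A y -> (forall n, parsed l n (P n y) x) -> x = coding y.
Proof. by move=> Ay px; exact: (parsed_unique hl Ay px (parsed_coding Ay)). Qed.

Lemma often_good_map y : A y -> A (odometer_map y).
Proof.
move=> Ay; apply: (good_often_next hl _ _ Ay) => [||n].
- exact: coherent_level_position.
- exact: coherent_level_position.
- exact: level_position_map.
Qed.

Lemma coding_map y : A y -> coding (odometer_map y) = shift_map (coding y).
Proof.
move=> Ay; apply/esym/coding_unique; first exact: often_good_map.
by move=> n; rewrite level_position_map//; apply: parsed_shift; exact: parsed_coding.
Qed.

Lemma coding_inj y y' : A y -> A y' -> coding y = coding y' -> y = y'.
Proof.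
move=> Ay Ay' e; apply: (level_position_inj hk) => n.
apply: (parsed_inj hl (level_position_lt hk n y) (level_position_lt hk n y')
  (parsed_coding Ay n)).
by rewrite e; exact: parsed_coding.
Qed.

Lemma coding_limit y : A y -> limit_system (words l) (coding y).
Proof. by move=> Ay; exact: (parsed_limit hl Ay (parsed_coding Ay)). Qed.

Lemma measurable_coding : measurable_fun setT coding.
Proof.
apply: measurable_fun_bisequence => i a.
(* On [A] the letter at [i] is read from [P n.+1 y] at any good level [n] at least the absolute
   value of [i]. *)
rewrite (_ : [set y | _] =
  A `&` \bigcup_(n in [set n | (`|i| <= n)%N])
     \bigcup_(r in [set r | good l n r /\
          letter l n.+1 0 `|(r%:Z + i)%R|%N = a]) [set y | P n.+1 y = r]
  `|` ~` A `&` (if (point : bisequence 'I_4) i == a then setT else set0)).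
  have mA := measurable_often_good hk.
  apply: measurableU; apply: measurableI => //.
  - apply: bigcup_measurable => n _; apply: bigcup_measurable => r _.
    exact: measurable_level.
  - exact: measurableC.
  - by case: ifP.
have E y n : A y -> (`|i| <= n)%N -> good l n (P n.+1 y) ->
    coding y i = letter l n.+1 0 `|((P n.+1 y)%:Z + i)%R|%N.
  move=> Ay ni gn; apply: (good_parsed hl gn (parsed_coding Ay _)).
  by have := height_gt hl n; lia.
apply/seteqP; split=> y /=.
  have [Ay|Ay] := pselect (A y).
    move=> ya; left; split=> //; have [n ni gn] := Ay `|i|%N.
    exists n => //; exists (P n.+1 y) => //; split=> //.
    exact: etrans (esym (E y n Ay ni gn)) ya.
  by rewrite /coding asboolF// => ->; right; rewrite eqxx.
move=> [[Ay [n /= ni [r /= [gr <-] yr]]]|[Ay]].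
  by rewrite (E y n)// yr.
by rewrite /coding asboolF//; case: eqP.
Qed.

Lemma measurable_parsed n r : measurable ([set x : Y | parsed l n r x]).
Proof.
rewrite (_ : [set x | _] = \bigcap_q \bigcup_(j in `I_(nwords n))
    \bigcap_(p in `I_(height l n)) [set x : Y |
       x ((q : int) * (height l n)%:Z + p%:Z - r%:Z) = letter l n j p]).
  apply: countable_bigcapT_measurable => q; apply: bigcup_measurable => j _.
  by apply: bigcap_measurableType => p _; exact: measurable_letter.
apply/seteqP; split=> x px q.
  by move=> _; have [j sj jE] := px q; exists j.
by have [j sj jE] := px q I; exists j.
Qed.

Lemma image_coding_level n r : (r < height l n)%N ->
  coding @` (A `&` [set y | P n y = r]) = coding @` A `&` [set x | parsed l n r x].
Proof.
move=> rh; apply/seteqP; split=> x.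
  move=> [y [Ay /= <-] <-]; split; first by exists y.
  exact: parsed_coding.
move=> [[y Ay <-] /= pr]; exists y => //; split=> //=.
exact: (parsed_inj hl (level_position_lt hk n y) rh (parsed_coding Ay n) pr).
Qed.

(** Good parsings at infinitely many levels give coherent residues, hence a point of the odometer;
    so the image is a countable combination of parsing conditions. *)
Lemma measurable_image_coding : measurable (coding @` A).
Proof.
rewrite (_ : coding @` A = \bigcap_N \bigcup_(n in [set n | (N <= n)%N])
    \bigcup_(r in [set r | (r < height l n.+1)%N /\ good l n r])
      [set x | parsed l n.+1 r x]).
  apply: bigcapT_measurable => N; apply: bigcup_measurable => n _.
  by apply: bigcup_measurable => r _; exact: measurable_parsed.
apply/seteqP; split=> [_ [y Ay <-] N _|x hx].
  have [n Nn gn] := Ay N; exists n => //; exists (P n.+1 y).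
    by split=> //; exact: level_position_lt.
  exact: parsed_coding.
have [N|Q [cQ gQ pQ]] := @parsed_coherent l hl x.
  by have [n Nn [r [rh gr] px]] := hx N I; exists n => //; exists r.
have [y yQ] := level_position_onto hk cQ.
have Ay : A y by move=> N; have [n Nn gn] := gQ N; exists n => //; rewrite yQ.
by exists y => //; apply/esym/coding_unique => // n; rewrite yQ.
Qed.

(* The sets [E] with measurable image form a sigma-algebra by injectivity, and it
   contains the cylinders by [image_coding_level]. *)
Lemma measurable_coding_image (E : set X) : measurable E ->
  measurable (coding @` (A `&` E)).
Proof.
have mA := measurable_image_coding.
suff : <<s @open (odometer_space k) >> `<=`
    [set E | measurable (coding @` (A `&` E))] by exact.
rewrite (sigma_odometer hk); apply: smallest_sub; last first.
  move=> _ [[n r] _ <-] /=; have [rh|hr] := ltnP r (height l n).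
    by rewrite image_coding_level//; apply: measurableI => //; exact: measurable_parsed.
  rewrite (_ : level_cylinder _ = set0).
    by rewrite setI0 image_set0; exact: measurable0.
  apply/seteqP; split=> // y; rewrite /level_cylinder/= => e.
  by have := level_position_lt hk n y; rewrite -/l; lia.
split=> [/=|B /= mB|F /= mF].
- by rewrite setI0 image_set0; exact: measurable0.
- rewrite (_ : coding @` _ = coding @` A `\` coding @` (A `&` B)).
    exact: measurableD.
  apply/seteqP; split=> x.
    move=> [y [Ay [_ By]] <-]; split; first by exists y.
    by move=> [y' [Ay' By'] /coding_inj yy']; apply: By; rewrite -yy'.
  move=> [[y Ay <-] nB]; exists y => //; split=> //; split=> // By.
  by apply: nB; exists y.
- rewrite setI_bigcupr image_bigcup; exact: bigcupT_measurable.
Qed.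

End Coding.

Theorem lemma25 (R : realType) (k : nat -> nat)
    (hk : forall n, (2 <= k n)%N)
    (mu : probability (borel (odometer_space k)) R)
    (hmu : uniform_product mu) :
  exists (S : pointedFinType) (l : nat -> nat) (W : nat -> set (seq S)),
    [/\ odometer_based l W,
        [/\ nonincreasing_seq (sup_freq R l W),
            sup_freq R l W @ \oo --> (0 : R),
            exponentially_fast (sup_freq R l W) &
            cvgn (series (sup_freq R l W))] &
        exists nu : probability (borel (bisequence S)) R,
          [/\ nu (limit_system W) = 1%E,
              invariant_measure nu (@shift_map S) &
              mt_isomorphic mu (@odometer_map k) nu (@shift_map S)]].
Proof.
have hl := coeff_large hk.
exists 'I_4, (coeff k), (words (coeff k)); split.
- exact: words_odometer_based.
- split; [exact: sup_freq_nonincreasing|exact: sup_freq_cvg0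
    |exact: sup_freq_exponentially_fast|exact: sup_freq_cvgn_series].
pose phi : {mfun borel (odometer_space k) >-> borel (bisequence 'I_4)} :=
  HB.pack (@coding k) (isMeasurableFun.Build _ _ _ _ _ (measurable_coding hk)).
pose A := @often_good k.
have mA : measurable A := measurable_often_good hk.
have muA : mu A = 1%E := measure_often_good hk hmu.
have mphi F : measurable F -> measurable (@coding k @^-1` F).
  by move=> mF; rewrite -[X in measurable X]setTI; exact: measurable_coding.
(* Identities between measures need only be checked inside [A], where the coding is equivariant. *)
have muAI E : measurable E -> mu (A `&` E) = mu E.
  move=> mE; have mAC := measurableC mA.
  have muAC : mu (~` A) = 0%E by rewrite probability_setC// muA subee.
  have mEA : measurable (E `\` A) by exact: measurableD.
  have muEA : mu (E `\` A) = 0%E.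
    by apply: (subset_measure0 mEA mAC) => // y [].
  have split : mu E = (mu (E `\` A) + mu (E `&` A))%E := measureDI mu mE mA.
  by rewrite split muEA add0e setIC.
have full E : measurable E -> A `<=` E -> mu E = 1%E.
  by move=> mE AE; rewrite -muAI// setIidl.
have mB := measurable_image_coding hk.
have sub_range : A `<=` @coding k @^-1` (@coding k @` A) by move=> y Ay; exists y.
(* The measure is the image of [mu] under the coding; its shift invariance comes from equivariance
   and the invariance of [mu]. *)
exists (distribution mu phi); split.
- apply: (full (@coding k @^-1` limit_system (words (coeff k)))).
    by apply: mphi; exact: measurable_limit_system.
  by move=> y Ay; exact: (coding_limit hk Ay).
- move=> E mE; have mS := measurable_shift mE.
  have mCE := mphi _ mE; have mCS := mphi _ mS.
  have mTE : measurable
      (@odometer_map k @^-1` (@coding k @^-1` E) : set (borel (odometer_space k))).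
    rewrite -[X in measurable X]setTI.
    exact: (measurable_odometer_map hk measurableT mCE).
  have eqA : A `&` @coding k @^-1` (@shift_map 'I_4 @^-1` E) =
      A `&` @odometer_map k @^-1` (@coding k @^-1` E).
    by apply/seteqP; split=> y [Ay]; rewrite /preimage/= (coding_map hk Ay).
  have : mu (@coding k @^-1` (@shift_map 'I_4 @^-1` E)) = mu (@coding k @^-1` E).
    by rewrite -(muAI _ mCS) eqA (muAI _ mTE); exact: odometer_map_invariant.
  exact.
- exists A, (@coding k @` A), (@coding k); split.
  + by split=> // _ [y Ay <-]; exact: often_good_map.
  + split=> //; first by apply: full => //; exact: mphi.
    move=> _ [_ [y Ay <-] <-]; exists (odometer_map y); first exact: often_good_map.
    exact: coding_map.
  + split=> [y Ay|y y'|//]; first by exists y.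
    by rewrite !inE; exact: coding_inj.
  + split.
    * exact: measurable_funTS (measurable_coding hk).
    * by move=> E mE EA; rewrite -(setIidr EA); exact: measurable_coding_image.
    * by move=> F mF; rewrite muAI//; exact: mphi.
  + by move=> y; exact: coding_map.
Qed.
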